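(* Let $X$ be an infinite Hausdorff space and let $p\in X_\Theta$ be a butterfly point of $X$ such that $X$ is totally disconnected at $p$. Then $p\in X_\Omega$, i.e. $p$ is countably-approachable.
   Context: All spaces are infinite Hausdorff topological spaces. $\mathscr{F}(X)$ is the set of all nonempty closed subsets of $X$, endowed with the Vietoris topology $\tau_V$, which is generated by the sets $\langle\mathscr{V}\rangle=\{S\in\mathscr{F}(X): S\subset\bigcup\mathscr{V}$ and $S\cap V\neq\varnothing$ for every $V\in\mathscr{V}\}$, where $\mathscr{V}$ runs over the finite families of open subsets of $X$. A selection for $\mathscr{F}(X)$ is a map $f:\mathscr{F}(X)\to X$ with $f(S)\in S$ for every $S\in\mathscr{F}(X)$; it is continuous if it is continuous with respect to $\tau_V$. $X_\Theta=\{f(X): f \text{ is a continuous selection for } \mathscr{F}(X)\}$. A point $p\in X$ is a butterfly point if $\overline{F\setminus\{p\}}\cap\overline{G\setminus\{p\}}=\{p\}$ for some closed sets $F,G\subset X$. $X$ is totally disconnected at $p\in X$ if $\{p\}$ is an intersection of clopen subsets of $X$. A point $p\in X$ is countably-approachable if it is either isolated or there is an open set $U\subset X\setminus\{p\}$ with $\overline{U}=U\cup\{p\}$ such that $p$ has a countable base of clopen sets in the subspace $\overline{U}$. $X_\Omega$ is the set of all countably-approachable points of $X$. *)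

(* Defs.v *)
From HB Require Import structures.
From mathcomp Require Import all_boot all_order all_algebra.
From mathcomp Require Import all_classical all_reals all_analysis.

Set Implicit Arguments.
Unset Strict Implicit.
Unset Printing Implicit Defensive.

Local Open Scope classical_set_scope.

Definition hyperspace (X : topologicalType) : Type :=
  set_type [set S : set X | closed S /\ S !=set0].

HB.instance Definition _ (X : topologicalType) :=
  Choice.copy (hyperspace X) (set_type [set S : set X | closed S /\ S !=set0]).

Definition hset (X : topologicalType) (S : hyperspace X) : set X := set_val S.

Definition vietoris_set (X : topologicalType) (V : set (set X)) :
    set (hyperspace X) :=
  [set S | hset S `<=` \bigcup_(A in V) A /\
           forall A, V A -> (hset S `&` A) !=set0].

Definition finite_open_family (X : topologicalType) : set (set (set X)) :=
  [set V | finite_set V /\ V `<=` @open X].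
Arguments finite_open_family : clear implicits.

HB.instance Definition _ (X : topologicalType) :=
  @isSubBaseTopological.Build (hyperspace X)
    (set (set X)) (finite_open_family X) (@vietoris_set X).

Definition selection (X : topologicalType) (f : hyperspace X -> X) : Prop :=
  forall S, hset S (f S).

(* The whole space is designated by its carrier; as an element of
   [hyperspace X] it is unique, and it exists as soon as X is nonempty. *)
Definition X_Theta (X : topologicalType) : set X :=
  [set p | exists f : hyperspace X -> X,
    [/\ selection f, continuous f &
        exists2 T : hyperspace X, hset T = [set: X] & f T = p]].
Arguments X_Theta : clear implicits.

Definition butterfly_point (X : topologicalType) (p : X) : Prop :=
  exists F G : set X,
    [/\ closed F, closed G &
        closure (F `\ p) `&` closure (G `\ p) = [set p]].

Definition totally_disconnected_at (X : topologicalType) (p : X) : Prop :=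
  exists2 C : set (set X), C `<=` @clopen X & \bigcap_(A in C) A = [set p].

Definition countable_clopen_base_at (Y : topologicalType) (y : Y) : Prop :=
  exists B : set (set Y),
    [/\ countable B, B `<=` @clopen Y, (forall W, B W -> W y) &
        forall V, nbhs y V -> exists2 W, B W & W `<=` V].

(* [closure U], used as a type, carries the subspace topology (the initial
   topology of its inclusion in X); q is the point p seen in it. *)
Definition countably_approachable (X : topologicalType) (p : X) : Prop :=
  open [set p] \/
  exists U : set X,
    [/\ open U, U `<=` ~` [set p], closure U = U `|` [set p] &
        exists2 q : closure U, set_val q = p & countable_clopen_base_at q].

Definition X_Omega (X : topologicalType) : set X :=
  [set p | countably_approachable p].
Arguments X_Omega : clear implicits.

(* Main.v *)
Require Import Defs.
From mathcomp Require Import all_boot all_order all_algebra.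
From mathcomp Require Import finmap.
From mathcomp Require Import all_classical all_reals all_analysis.

(** The point p is countably-approachable as soon as some sequence of nonempty
clopen sets C_n missing p converges to p, in the sense that every neighbourhood
of p contains all but finitely many of them
([clopen_seq_countably_approachable]): take for U the union of the C_n.

Such clopen sets come from a continuous selection g with g(X) = p. If B is
closed and Q is clopen with g(B) outside Q, then the set C of the points y
outside B with g(B u {y}) = y and y in Q is clopen ([sel_add_clopen]). If
moreover B_n and M are such that B_n u {y} tends to M in the Vietoris topology
for all choices of y in the corresponding C_n, then continuity of g at M says
that y = g(B_n u {y}) tends to g(M): the sets C_n converge to g(M)
([sel_seq_cvg]). So it suffices to find B_n with nonempty C_n and a limit M
with g(M) = p. The B_n are built along an increasing sequence of clopen sets
S_n missing p, and there are two cases.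

Confined case: for some clopen S0 missing p, every closed T containing S0 and p
satisfies g(T) = p or g(T) in S0. Since g(X) = p, large clopen sets B missing p
satisfy g(B u {p}) = p ([fixing_of_confined]). Hence g(B u {y}) = y for all y
near p, and y may be chosen in either wing of the butterfly. Choosing the two
wings alternately, with S_n inside B_n and B_n u C_n inside S_(n+1), gives a
limit M, the closure of the union of the S_n, for which g(M) is adherent to both wings;
therefore g(M) = p ([approachable_of_fixing]).

Escaping case: every clopen S missing p lies in a closed T containing p with
g(T) neither in S nor equal to p. Separate g(T) from p and from S by a clopen
Q. By Zorn's lemma T grows to a clopen Z with g(Z) in Q
([sel_clopen_enlargement]). As g(Z \ Q) is not in Q while g(Z) is, adding
finitely many points of Q to Z \ Q produces B for which one further point l
gives g(B u {l}) = l in Q ([sel_finite_jump]), and so a nonempty C. Here B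
contains both S and the complement of the next clopen set S u Q u ~Z. Hence
each point of X belongs to almost all B_n, the limit M is X itself, and
g(X) = p ([approachable_of_escaping]). *)

Local Open Scope classical_set_scope.

(** * Selections as functions of arbitrary subsets *)

Lemma nbhs_vietorisP (X : topologicalType) (S : hyperspace X)
  (N : set (hyperspace X)) : nbhs S N ->
  exists2 E : set (set (set X)), finite_set E &
    (forall V, E V -> finite_open_family X V /\ vietoris_set V S) /\
    (forall T, (forall V, E V -> vietoris_set V T) -> N T).
Proof.
rewrite nbhsE => -[B [oB BS] BN].
have [D' sD' BE] := oB; move: BS; rewrite -BE => -[A D'A AS].
have [E sE AE] := sD' _ D'A.
exists [set` E]; first exact: finite_fset.
split=> [V VE|T TE].
  split; first by have := sE _ VE; rewrite inE.
  by move: (AS : A S); rewrite -AE; apply.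
apply: BN; rewrite -BE; exists A => //.
by suff : A T by []; rewrite -AE => V VE; exact: TE.
Qed.

Lemma hyperspace_closed (X : topologicalType) (S : hyperspace X) :
  closed (hset S).
Proof. by case: S => S /= /[dup] /set_mem []. Qed.

Lemma hyperspace_neq0 (X : topologicalType) (S : hyperspace X) :
  hset S !=set0.
Proof. by case: S => S /= /[dup] /set_mem []. Qed.

(** Inside S, a Vietoris neighbourhood of S only asks that finitely many open
sets be met, and D, being dense in S, meets each of them. Limits of increasing
unions, finite approximations and exhaustions of X are all instances. *)
Lemma nbhs_vietoris_finite (X : topologicalType) (S : hyperspace X)
  (D : set X) (N : set (hyperspace X)) :
  D `<=` hset S -> hset S `<=` closure D -> nbhs S N ->
  exists K : seq X, [set` K] `<=` D /\
    forall T, [set` K] `<=` hset T -> hset T `<=` hset S -> N T.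
Proof.
move=> DS SD /nbhs_vietorisP[E finE [ES EN]].
pose G := \bigcup_(V in E) V.
have finG : finite_set G.
  by apply: bigcup_finite => // V /= /ES[[]].
have /choice[h hP] : forall A, exists x, G A -> D x /\ A x.
  move=> A; have [[V VE VA]|nG] := pselect (G A); last first.
    by have [x _] := hyperspace_neq0 X S; exists x.
  have [[_ Vo] [_ /(_ _ VA)[x [Sx Ax]]]] := ES _ VE.
  have [y [Dy Ay]] := SD _ Sx A (open_nbhs_nbhs (conj (Vo _ VA) Ax)).
  by exists y.
have /finite_seqP[K KE] : finite_set (h @` G) by exact: finite_image.
exists K; split; first by rewrite -KE => _ [A /hP[? _] <-].
move=> T KT TS; apply: EN => V VE; have [_ [SV _]] := ES _ VE.
split; first exact: subset_trans TS SV.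
move=> A VA; have GA : G A by exists V.
exists (h A); split; last by have [] := hP _ GA.
by apply: KT; rewrite -KE; exists A.
Qed.

(** A total function on subsets avoids carrying closedness and nonemptiness
proofs; its value p elsewhere is junk. *)
Definition extend_selection (X : topologicalType) (f : hyperspace X -> X)
    (p : X) (A : set X) : X :=
  if pselect (closed A /\ A !=set0) is left h
  then f (exist _ A (mem_set h)) else p.

Lemma extend_selectionE (X : topologicalType) (f : hyperspace X -> X)
    (p : X) (S : hyperspace X) : extend_selection X f p (hset S) = f S.
Proof.
rewrite /extend_selection; case: pselect => [h|]; last first.
  by case; split; [exact: hyperspace_closed|exact: hyperspace_neq0].
by congr f; apply: val_inj.
Qed.

Lemma hyperspace_of (X : topologicalType) (A : set X) :
  closed A -> A !=set0 -> exists S : hyperspace X, hset S = A.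
Proof.
by move=> cA nA; exists (exist _ A (mem_set (conj cA nA))).
Qed.

(** What the proof retains from the continuity of a selection: continuity from
inside at a set given by a dense subset, and continuity of adding one point. *)
Record set_selection (X : topologicalType) (g : set X -> X) : Prop := {
  sel_mem : forall A, closed A -> A !=set0 -> A (g A) ;
  sel_approx : forall (D O : set X), D !=set0 -> nbhs (g (closure D)) O ->
    exists K : seq X, [set` K] `<=` D /\
      forall T, closed T -> [set` K] `<=` T -> T `<=` closure D -> O (g T) ;
  sel_add : forall B, closed B -> continuous (fun y => g (B `|` [set y])) }.

Lemma extend_set_selection (X : topologicalType) (f : hyperspace X -> X)
    (p : X) : hausdorff_space X ->
  selection f -> continuous f -> set_selection X (extend_selection X f p).
Proof.
move=> hX fS fC; split.
- move=> A cA /(hyperspace_of _ _ cA)[S <-].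
  by rewrite extend_selectionE; exact: fS.
- move=> D O [d Dd].
  have [||S SE] := hyperspace_of X (closure D).
  + exact: closed_closure.
  + by exists d; exact: subset_closure.
  rewrite -SE extend_selectionE => /(fC S) ON.
  have [|| K [KD KN]] := nbhs_vietoris_finite X S D _ _ _ ON.
  + by rewrite SE; exact: subset_closure.
  + by rewrite SE.
  exists (d :: K); split=> [x /=|T cT KT TS].
    by rewrite inE => /orP[/eqP->|/KD].
  have [|T' T'E] := hyperspace_of X T cT.
    by exists d; apply: KT => /=; rewrite inE eqxx.
  rewrite -T'E extend_selectionE; apply: KN; rewrite T'E//.
  by move=> x xK; apply: KT => /=; rewrite inE xK orbT.
- move=> B cB y.
  have cl1 z : closed (B `|` [set z]).
    apply: closedU => //; exact: accessible_closed_set1 (hausdorff_accessible hX) _.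
  have /choice[s sE] : forall z, exists S : hyperspace X, hset S = B `|` [set z].
    by move=> z; apply: hyperspace_of => //; exists z; right.
  have -> : (fun z => extend_selection X f p (B `|` [set z])) = f \o s.
    by apply/funext => z /=; rewrite -sE extend_selectionE.
  apply: (@continuous_comp _ _ _ s f); last exact: fC.
  move=> N /nbhs_vietorisP[E finE [ES EN]].
  have /finite_fsetP[E' E'E] := finE.
  have : nbhs y (\bigcap_(V in [set` E']) [set z | vietoris_set V (s z)]).
    apply: filter_bigI => V VE'.
    have VE : E V by rewrite E'E.
    have [[finV Vo] [yV Vy]] := ES _ VE; rewrite sE in yV Vy.
    have [A VA Ay] : (\bigcup_(A in V) A) y by apply: yV; right.
    have near_sub : \forall z \near y, hset (s z) `<=` \bigcup_(A in V) A.
      have := open_nbhs_nbhs (conj (Vo _ VA) Ay).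
      apply: filterS => z Az; rewrite sE => x [Bx|->]; last by exists A.
      by apply: yV; left.
    have near_meet : \forall z \near y, forall A', V A' -> hset (s z) `&` A' !=set0.
      have /finite_fsetP[V' V'E] := finV.
      have : nbhs y (\bigcap_(A' in [set` V']) [set z | hset (s z) `&` A' !=set0]).
        apply: filter_bigI => A' VA'0.
        have VA' : V A' by rewrite V'E.
        have [x [[Bx|xy] A'x]] := Vy _ VA'.
          by apply: nearW => z; exists x; split=> //; rewrite sE; left.
        have := open_nbhs_nbhs (conj (Vo _ VA') A'x); rewrite xy.
        by apply: filterS => z A'z; exists z; split=> //; rewrite sE; right.
      by apply: filterS => z zV A'; rewrite V'E => /zV.
    by near=> z; split; near: z.
  by apply: filterS => z zE; apply: EN => V; rewrite E'E => /zE.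
  Unshelve. all: by end_near.
Qed.

(** * Clopen sets produced by a selection *)

Lemma hausdorff_closed1 (X : topologicalType) (x : X) :
  hausdorff_space X -> closed [set x].
Proof. by move=> hX; exact: accessible_closed_set1 (hausdorff_accessible hX) _. Qed.

Lemma closed_set_seq (X : topologicalType) (K : seq X) :
  hausdorff_space X -> closed [set` K].
Proof.
move=> /hausdorff_accessible/accessible_finite_set_closed; apply.
exact: finite_seq.
Qed.

Lemma closed_fixpoints (X : topologicalType) (h : X -> X) :
  hausdorff_space X -> continuous h -> closed [set y | h y = y].
Proof.
move=> hX hc y yF; apply: hX => A B Ay By.
have hA : nbhs y (h @^-1` A) by exact: hc.
have [z [hz [Az Bz]]] := yF _ (filterI hA By).
by exists z; split=> //; rewrite -hz.
Qed.

(** All sets B_n u {y} with y in C_n lie between B_n and the closure of D, so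
they tend to that closure uniformly in the choice of y. *)
Lemma sel_seq_cvg (X : topologicalType) (g : set X -> X) (D : set X)
    (B C : nat -> set X) :
  hausdorff_space X -> set_selection X g -> D !=set0 ->
  (forall x, D x -> \forall n \near \oo, B n x) ->
  (forall n, closed (B n)) ->
  (forall n y, C n y -> B n `|` [set y] `<=` closure D /\ g (B n `|` [set y]) = y) ->
  forall O, nbhs (g (closure D)) O -> \forall n \near \oo, C n `<=` O.
Proof.
move=> hX hg D0 DB cB BC O /(sel_approx _ _ hg _ _ D0)[K [KD KO]].
have : \forall n \near \oo, [set` K] `<=` B n.
  elim: K KD {KO} => [_|x K IH KD]; first by apply: nearW => n y.
  have := IH _; have := DB x _.
  move=> /(_ (KD _ (mem_head _ _))) Bx /(_ _)[|n0 _ n0K].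
    by move=> y yK; apply: KD => /=; rewrite inE yK orbT.
  apply: filterS2 Bx (nbhs_infty_ge n0) => n Bnx n0n y /=.
  by rewrite inE => /orP[/eqP->//|]; apply: n0K.
apply: filterS => n KB y Cy; have [sD <-] := BC n y Cy.
apply: KO => //; first by apply: closedU => //; exact: hausdorff_closed1.
by move=> x /KB; left.
Qed.

(** Continuity of y |-> g (B u {y}) makes C open. The set C is closed because,
on the preimage of Q, being outside B amounts to the closed condition
g (B u {y}) = y: a point y of B has g (B u {y}) = g B, which is not in Q. *)
Lemma sel_add_clopen (X : topologicalType) (g : set X -> X) (B Q : set X) :
  hausdorff_space X -> set_selection X g -> closed B -> clopen Q ->
  (forall y, B y -> ~ Q (g B)) ->
  let C := [set y | (Q `\` B) (g (B `|` [set y]))] in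
  clopen C /\ forall y, C y -> g (B `|` [set y]) = y.
Proof.
move=> hX hg cB [oQ cQ] nQ C.
have gB y : (Q `\` B) (g (B `|` [set y])) -> g (B `|` [set y]) = y.
  have [||Bg [_ /(_ Bg)] //|//] := sel_mem _ _ hg (B `|` [set y]).
    by apply: closedU => //; exact: hausdorff_closed1.
  by exists y; right.
split=> //; have cont := sel_add _ _ hg _ cB; split.
  apply: (open_comp (f := fun y => g (B `|` [set y]))) => [y _|]; first exact: cont.
  by rewrite setDE; apply: openI => //; exact: closed_openC.
have -> : C = (fun y => g (B `|` [set y])) @^-1` Q `&`
              [set y | g (B `|` [set y]) = y].
  apply/seteqP; split=> [y Cy|y [Qy yE]]; first by split; [case: Cy|exact: gB].
  split=> // By; rewrite yE in By; apply: (nQ _ By).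
  by move: Qy => /=; rewrite (_ : B `|` [set y] = B)//; apply/setUidPl => _ ->.
apply: closedI; first exact: preimage_closed.
exact: closed_fixpoints.
Qed.

(** A set Z maximal for the condition g Z in Q is closed, since the condition
passes to closures of increasing unions. By maximality
Z = {y | g (Z u {y}) in Q}, the preimage of an open set, so Z is open too. *)
Lemma sel_clopen_enlargement (X : topologicalType) (g : set X -> X) (T Q : set X) :
  hausdorff_space X -> set_selection X g -> closed T -> T !=set0 ->
  clopen Q -> Q (g T) -> exists Z, [/\ clopen Z, T `<=` Z & Q (g Z)].
Proof.
move=> hX hg cT T0 [oQ cQ] QT.
pose P := [set A | Q (g (closure (A `|` T)))].
have [|A [PA maxA]] := @Zorn_bigcup X P.
  move=> F FP totF; have [F0|/set0P[A0 FA0]] := eqVneq F set0.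
    by rewrite F0 bigcup_set0 /P /= set0U -(closure_id T).1.
  apply: contrapT => nQ.
  have D0 : \bigcup_(A in F) A `|` T !=set0 by case: T0 => t Tt; exists t; right.
  have [|K [KD KO]] := sel_approx _ _ hg _ (~` Q) D0.
    by apply: open_nbhs_nbhs; split=> //; exact: closed_openC.
  (* the chain absorbs the finite set K in one of its members *)
  have [A FA KA] : exists2 A, F A & [set` K] `<=` A `|` T.
    elim: K KD {KO} => [_|x K IH KD]; first by exists A0.
    have [|A FA KA] := IH; first by move=> y yK; apply: KD; rewrite /= inE yK orbT.
    have [[A' FA' A'x]|Tx] := KD x (mem_head _ _).
      have [AA'|A'A] := totF _ _ FA FA'.
        exists A' => // y /=; rewrite inE => /orP[/eqP->|/KA[/AA'|]]; by [left|right].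
      exists A => // y /=; rewrite inE => /orP[/eqP->|/KA//]; left; exact: A'A.
    by exists A => // y /=; rewrite inE => /orP[/eqP->|/KA//]; right.
  apply: (KO (closure (A `|` T))); [exact: closed_closure| | |exact: FP].
    by move=> y /KA; exact: subset_closure.
  by apply: closureS => y [Ay|]; [left; exists A|right].
pose Z := closure (A `|` T).
have cZ : closed Z by exact: closed_closure.
have TZ : T `<=` Z by move=> t Tt; apply: subset_closure; right.
have AZ : A `<=` Z by move=> t At; apply: subset_closure; left.
have maxZ y : Q (g (Z `|` [set y])) -> Z y.
  move=> Qy; apply: contrapT => nZy; apply: (maxA (Z `|` [set y])).
    split; last by move=> s; apply: nZy; apply: AZ; apply: s; right.
    by apply: subset_trans AZ _ => z; left.
  rewrite /P /= (_ : _ `|` T = Z `|` [set y]); last first.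
    by apply/setUidPl => t /TZ; left.
  rewrite -(closure_id _).1 //; apply: closedU => //; exact: hausdorff_closed1.
exists Z; split=> //; split=> //.
have -> : Z = (fun y => g (Z `|` [set y])) @^-1` Q.
  apply/seteqP; split=> y; last exact: maxZ.
  move=> Zy /=; rewrite (_ : Z `|` [set y] = Z)//; apply/setUidPl => _ ->//.
by apply: open_comp => // y _; exact: (sel_add _ _ hg).
Qed.

(** * Convergent sequences of clopen sets *)

(** A point x other than p has a neighbourhood disjoint from a neighbourhood of
p, hence from almost all C_n, and finitely many closed sets do not matter. *)
Lemma closure_bigcup_cvg (X : topologicalType) (p : X) (C : nat -> set X) (k : nat) :
  hausdorff_space X -> (forall n, closed (C n)) -> (forall n, C n !=set0) ->
  (forall O, nbhs p O -> \forall n \near \oo, C n `<=` O) ->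
  closure (\bigcup_(n in [set n | (k <= n)%N]) C n) =
  (\bigcup_(n in [set n | (k <= n)%N]) C n) `|` [set p].
Proof.
move=> hX cC C0 Cp; set U := \bigcup_(n in _) C n.
apply/seteqP; split=> [x xU|x [Ux|->]]; last 2 first.
- exact: subset_closure.
- move=> O /Cp CO.
  have [N _ NO] := filterI CO (nbhs_infty_ge k).
  have [CNO kN] := NO N (leqnn N).
  by have [y Cy] := C0 N; exists y; split; [exists N|exact: CNO].
apply: contrapT => /not_orP[nUx xp].
apply: xp; apply/esym; apply: hX => A B /Cp[N _ CA] Bx.
have nearC : forall M, \forall z \near x, forall n, (k <= n < M)%N -> ~ C n z.
  elim=> [|M IH]; first by apply: nearW => z n; rewrite ltn0 andbF.
  have nearM : \forall z \near x, (k <= M)%N -> ~ C M z.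
    have [kM|] := leqP k M; last by move=> ?; apply: nearW.
    have : nbhs x (~` C M).
      apply: open_nbhs_nbhs; split; first exact: closed_openC.
      by move=> CMx; apply: nUx; exists M.
    by apply: filterS => z nC _.
  apply: filterS2 IH nearM => z nz zM n /andP[kn].
  rewrite ltnS leq_eqVlt => /orP[/eqP nM|nM].
    by rewrite nM; apply: zM; rewrite -nM.
  by apply: nz; rewrite kn.
have [y [[n /= kn Cny] [By nyC]]] := xU _ (filterI Bx (nearC N)).
exists y; split=> //; apply: (CA n) => //=; rewrite leqNgt; apply/negP => nN.
by apply: (nyC n) => //; rewrite kn.
Qed.

(** The tails of the sequence, with p added, form the countable base. The
k-th tail is open in the closure of the union because C_0, ..., C_(k-1) are
closed and miss p, and the points of that closure outside them are in the
tail. *)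
Lemma clopen_seq_countably_approachable (X : topologicalType) (p : X)
    (C : nat -> set X) :
  hausdorff_space X -> (forall n, clopen (C n)) -> (forall n, C n !=set0) ->
  (forall n, ~ C n p) ->
  (forall O, nbhs p O -> \forall n \near \oo, C n `<=` O) ->
  countably_approachable p.
Proof.
move=> hX clC C0 nCp Cp; right.
have oC n : open (C n) by have [] := clC n.
have cC n : closed (C n) by have [] := clC n.
pose tail k := \bigcup_(n in [set n | (k <= n)%N]) C n.
have tailE k : closure (tail k) = tail k `|` [set p].
  exact: closure_bigcup_cvg.
have otail k : open (tail k) by apply: bigcup_open.
have pU : closure (tail 0%N) p by rewrite tailE; right.
exists (tail 0%N); split=> //.
- by move=> x [n _ Cx] xp; apply: (nCp n); rewrite -xp.
exists (exist _ p (mem_set pU)) => //.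
have cval : continuous (set_val : closure (tail 0%N) -> X).
  exact: initial_continuous.
pose W k : set (closure (tail 0%N)) := set_val @^-1` (closure (tail k)).
exists (range W); split.
- exact: (card_le_trans (card_image_le _ _) (countableP _)).
- move=> _ [k _ <-]; split.
    have -> : W k = set_val @^-1` (~` (\bigcup_(n in `I_k) C n) `|` tail k).
      apply/seteqP; split=> -[x xU]; rewrite /W /= (tailE k).
        case=> [|xp]; first by right.
        left; rewrite xp => -[n _]; exact: nCp.
      case=> [nx|]; last by left.
      have : (tail 0%N `|` [set p]) x by rewrite -tailE; exact: set_mem xU.
      case=> [[n _ Cnx]|]; last by right.
      left; exists n => //=; rewrite leqNgt; apply/negP => nk.
      by apply: nx; exists n.
    apply: open_comp => //.
    apply: openU => //; apply: closed_openC; apply: closed_bigcup => // n _.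
  by apply: preimage_closed => //; exact: closed_closure.
- by move=> _ [k _ <-]; rewrite /W /= (tailE k); right.
- move=> V; rewrite nbhsE => -[_ [[A oA <-] Ap] AV].
  have [N _ NA] := Cp A (open_nbhs_nbhs (conj oA Ap)).
  exists (W N); first by exists N.
  apply: subset_trans AV => -[x xU]; rewrite /W /= (tailE N) => -[[n Nn Cx]|xp].
    exact: (NA n).
  by move: Ap; rewrite /preimage /= xp.
Qed.

Lemma clopen_separate (X : topologicalType) (p x : X) :
  totally_disconnected_at p -> x <> p -> exists H, [/\ clopen H, H x & ~ H p].
Proof.
move=> [F Fcl FE] xp.
have : ~ (\bigcap_(A in F) A) x by rewrite FE.
move=> /existsNP[A /not_implyP[FA nAx]]; exists (~` A); split=> //.
  by apply: clopenC => //; exact: Fcl.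
have Fp : (\bigcap_(A in F) A) p by rewrite FE.
by apply; exact: Fp.
Qed.

Lemma clopen_cover_seq (X : topologicalType) (p : X) (K : seq X) :
  totally_disconnected_at p ->
  exists S, [/\ clopen S, ~ S p & [set` K] `<=` S `|` [set p]].
Proof.
move=> tdp; elim: K => [|x K [S [clS Sp KS]]].
  by exists set0; split=> //; exact: clopen0.
have [->|/eqP xp] := eqVneq x p.
  by exists S; split=> // y; rewrite /= inE => /orP[/eqP->|/KS//]; right.
have [H [clH Hx Hp]] := clopen_separate _ _ _ tdp xp.
exists (S `|` H); split; first exact: clopenU.
  by case.
move=> y; rewrite /= inE => /orP[/eqP->|/KS[]]; first by left; right.
  by left; left.
by right.
Qed.

(** * The two constructions *)

(** The step may depend on n, which serves to alternate between the two wings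
of a butterfly, and records auxiliary data u. *)
Lemma dependent_choice_spec (T U : Type) (P : T -> Prop)
    (R : nat -> T -> T -> U -> Prop) (t0 : T) :
  P t0 -> (forall n t, P t -> exists t' u, P t' /\ R n t t' u) ->
  exists (t : nat -> T) (u : nat -> U),
    forall n, P (t n) /\ R n (t n) (t n.+1) (u n).
Proof.
move=> P0 step; have [_ [u0 _]] := step 0%N t0 P0.
have /choice[h hP] : forall z : nat * T, exists w : T * U,
    P z.2 -> P w.1 /\ R z.1 z.2 w.1 w.2.
  move=> [n t]; have [/(step n)[t' [u tu]]|nP] := pselect (P t).
    by exists (t', u).
  by exists (t0, u0).
pose t := nat_rect (fun=> T) t0 (fun n s => (h (n, s)).1).
have Pt n : P (t n) by elim: n => // n /(hP (n, t n))[].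
exists t, (fun n => (h (n, t n)).2) => n; split=> //.
by have [] := hP (n, t n) (Pt n).
Qed.

(** The value of g at B0 u K lies in Q, hence is a point l of K. Either removing
l brings the value back out of Q, and B = B0 u (K minus l) is as wanted, or
K minus l is a smaller set with the same property. *)
Lemma sel_finite_jump (X : topologicalType) (g : set X -> X) (B0 Q : set X)
    (K : seq X) :
  hausdorff_space X -> set_selection X g -> closed B0 ->
  (forall x, B0 x -> ~ Q x) -> ~ Q (g B0) -> Q (g (B0 `|` [set` K])) ->
  exists B l, [/\ closed B, B0 `<=` B, ~ Q (g B), Q l & g (B `|` [set l]) = l].
Proof.
move=> hX hg cB0 BQ nQ; have [n] := ubnP (size K); elim: n K => // n IH K.
rewrite ltnS => Kn QK; set l := g (B0 `|` [set` K]).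
have clK (L : seq X) : closed (B0 `|` [set` L]).
  by apply: closedU => //; exact: closed_set_seq.
have [||/BQ//|lK] := sel_mem _ _ hg (B0 `|` [set` K]) => //.
  apply: contrapT => K0; apply: nQ; move: QK; congr (Q (g _)).
  apply/seteqP; split=> x Bx; last by left.
  by exfalso; apply: K0; exists x.
pose L := [seq x <- K | x != l].
have KE : B0 `|` [set` K] = (B0 `|` [set` L]) `|` [set l].
  apply/seteqP; split=> x.
    case=> [Bx|/= xK]; first by left; left.
    have [->|xl] := eqVneq x l; first by right.
    by left; right; rewrite /= mem_filter xl.
  case=> [[Bx|]|->]; [by left| |by right].
  by rewrite /= mem_filter => /andP[_ xK]; right.
have [QL|nQL] := pselect (Q (g (B0 `|` [set` L]))).
  apply: (IH L) => //; apply: leq_trans Kn.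
  rewrite size_filter -(count_predC (pred1 l) K) -[X in (X < _)%N]add0n.
  by rewrite ltn_add2r -has_count; apply/hasP; exists l => /=.
exists (B0 `|` [set` L]), l; split=> //.
by rewrite -KE.
Qed.

(** Since g (B u {p}) = p, points y near p satisfy g (B u {y}) = y, and such y
exist in both F and G. Visiting F at even steps and G at odd steps forces the
limit value into the closures of both F minus p and G minus p. *)
Lemma approachable_of_fixing (X : topologicalType) (g : set X -> X) (p : X) :
  hausdorff_space X -> set_selection X g -> totally_disconnected_at p ->
  butterfly_point p ->
  (forall S, clopen S -> ~ S p -> exists B,
    [/\ clopen B, S `<=` B, ~ B p & g (B `|` [set p]) = p]) ->
  countably_approachable p.
Proof.
move=> hX hg tdp [F [G [_ _ FG]]] fix_p.
have [pF pG] : closure (F `\ p) p /\ closure (G `\ p) p.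
  by have : (closure (F `\ p) `&` closure (G `\ p)) p by rewrite FG.
pose E n := if odd n then G else F.
pose P (S : set X) := clopen S /\ ~ S p.
pose R n S S' (BC : set X * set X) :=
  [/\ closed BC.1, S `<=` BC.1, BC.1 `|` BC.2 `<=` S' & 
   [/\ clopen BC.2, ~ BC.2 p, BC.2 `&` (E n `\ p) !=set0 &
    forall y, BC.2 y -> g (BC.1 `|` [set y]) = y]].
have [||S [BC SBC]] := @dependent_choice_spec _ _ P R set0.
- by split; [exact: clopen0|case].
- move=> n S [clS nSp]; have [B [clB SB nBp gBp]] := fix_p S clS nSp.
  have cB : closed B by case: clB.
  have [|clC gC] := sel_add_clopen _ _ _ _ hX hg cB (clopenC B clB).
    by move=> y By; apply; apply: (sel_mem _ _ hg) => //; exists y.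
  set C := [set y | _] in clC gC.
  have Cp : C p by rewrite /C /= gBp; split.
  have [y [Ey Cy]] : (E n `\ p) `&` C !=set0.
    have nC : nbhs p C by apply: open_nbhs_nbhs; split=> //; case: clC.
    by rewrite /E; case: odd; [exact: pG|exact: pF].
  (* C is a neighbourhood of p; cut it down so that it misses p but keeps y *)
  have [H [clH Hy nHp]] := clopen_separate _ _ _ tdp Ey.2.
  have clCH : clopen (C `&` H) by exact: clopenI.
  exists (B `|` (C `&` H)), (B, C `&` H); split.
    by split; [exact: clopenU|case=> [//|[]]].
  split=> //; split=> //=; first by case.
    by exists y.
  by move=> z [Cz _]; exact: gC.
pose D := \bigcup_n S n.
have clD n y : (BC n).2 y ->
    (BC n).1 `|` [set y] `<=` closure D /\ g ((BC n).1 `|` [set y]) = y.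
  move=> Cy; have [_ [_ _ sub [_ _ _ gE]]] := SBC n; split; last exact: gE.
  move=> x xBy; apply: subset_closure; exists n.+1 => //; apply: sub.
  by case: xBy => [|->]; [left|right].
have C0 n : (BC n).2 !=set0.
  by have [_ [_ _ _ [_ _ [y [Cy _]] _]]] := SBC n; exists y.
have cvgC : forall O, nbhs (g (closure D)) O ->
    \forall n \near \oo, (BC n).2 `<=` O.
  apply: (sel_seq_cvg _ _ D (fun n => (BC n).1) (fun n => (BC n).2)) => //.
  - have [y Cy] := C0 0%N; exists y; exists 1%N => //.
    by have [_ [_ _ + _]] := SBC 0%N; apply; right.
  - move=> x [m _ Smx]; exists m => // n /= mn.
    have [_ [_ + _ _]] := SBC n; apply; rewrite -(subnK mn).
    elim: (n - m)%N => // k IH; rewrite addSn.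
    have [_ [_ SB BS _]] := SBC (k + m)%N; apply: BS; left; exact: SB.
  - by move=> n; have [_ []] := SBC n.
have gD : g (closure D) = p.
  have : [set p] (g (closure D)); last by [].
  have meet O b : nbhs (g (closure D)) O ->
      exists n, odd n = b /\ (E n `\ p) `&` O !=set0.
    move=> /cvgC[N _ NO]; pose n := (N.*2 + b)%N.
    exists n; split; first by rewrite /n oddD odd_double; case: b @n.
    have [_ [_ _ _ [_ _ [y [Cy Ey]] _]]] := SBC n.
    exists y; split=> //; apply: (NO n) => //=.
    by rewrite /n -addnn -addnA leq_addr.
  rewrite -FG; split=> O.
    by move=> /(meet _ false)[n [nb]]; rewrite /E nb.
  by move=> /(meet _ true)[n [nb]]; rewrite /E nb.
apply: (clopen_seq_countably_approachable _ _ (fun n => (BC n).2)) => //.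
- by move=> n; have [_ [_ _ _ []]] := SBC n.
- by move=> n; have [_ [_ _ _ []]] := SBC n.
- by move=> O; rewrite -gD; exact: cvgC.
Qed.

(** The sets B_n exhaust X: a point of some S_m lies in B_n for n >= m, and a
point of no S_m lies in every B_n, because B_n contains the complement of
S_(n+1). So the limit value is g X = p. *)
Lemma approachable_of_escaping (X : topologicalType) (g : set X -> X) (p : X) :
  hausdorff_space X -> set_selection X g -> totally_disconnected_at p ->
  g [set: X] = p ->
  (forall S, clopen S -> ~ S p -> exists T,
    [/\ closed T, S `<=` T, T p, ~ S (g T) & g T <> p]) ->
  countably_approachable p.
Proof.
move=> hX hg tdp gT escape.
pose P (S : set X) := clopen S /\ ~ S p.
pose R (n : nat) S S' (BC : set X * set X) :=
  [/\ closed BC.1, S `<=` BC.1, S `<=` S', ~` S' `<=` BC.1 &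
   [/\ clopen BC.2, ~ BC.2 p, BC.2 !=set0 &
    forall y, BC.2 y -> g (BC.1 `|` [set y]) = y]].
have [||S [BC SBC]] := @dependent_choice_spec _ _ P R set0.
- by split; [exact: clopen0|case].
- move=> n S [clS nSp]; have [T [cT ST Tp nSg gTp]] := escape S clS nSp.
  have [H [clH Hg nHp]] := clopen_separate _ _ _ tdp gTp.
  pose Q := H `\` S.
  have clQ : clopen Q by rewrite /Q setDE; apply: clopenI => //; exact: clopenC.
  have nQp : ~ Q p by case.
  have T0 : T !=set0 by exists p.
  have [//|Z [clZ TZ QZ]] := sel_clopen_enlargement _ _ T Q hX hg cT T0 clQ.
  have [oZ cZ] := clZ; have [oQ cQ] := clQ.
  pose B0 := Z `\` Q.
  have cB0 : closed B0 by rewrite /B0 setDE; apply: closedI => //; exact: open_closedC.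
  have B0p : B0 p by split=> //; exact: TZ.
  have B0Q x : B0 x -> ~ Q x by case.
  have nQB0 : ~ Q (g B0) by apply: B0Q; apply: (sel_mem _ _ hg) => //; exists p.
  have ZE : closure Z = Z by apply/esym; exact/closure_id.
  have Z0 : Z !=set0 by exists p; exact: TZ.
  have [|K [KZ KQ]] := sel_approx _ _ hg Z Q Z0.
    by rewrite ZE; apply: open_nbhs_nbhs.
  have QK : Q (g (B0 `|` [set` K])).
    apply: KQ; rewrite ?ZE.
    - by apply: closedU => //; exact: closed_set_seq.
    - by move=> x; right.
    - by move=> x [[]//|/KZ].
  have [B [l [cB B0B nQB Ql gl]]] := sel_finite_jump _ _ _ _ _ hX hg cB0 B0Q nQB0 QK.
  have [|clC gC] := sel_add_clopen _ _ B Q hX hg cB clQ; first by [].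
  set C := [set y | _] in clC gC.
  exists (S `|` Q `|` ~` Z), (B, C); split.
    split; first by apply: clopenU; [exact: clopenU|exact: clopenC].
    by case=> [[]//|]; apply; exact: TZ.
  split=> //=.
  - move=> x Sx; apply: B0B; split; first by apply/TZ/ST.
    by case.
  - by move=> x Sx; left; left.
  - move=> x nx; apply: B0B; split.
      by apply: contrapT => nZ; apply: nx; right.
    by move=> Qx; apply: nx; left; right.
  - split=> //.
      by move=> Cp; have := gC _ Cp; case: Cp => [+ _] gp; rewrite gp.
    exists l; rewrite /C /= gl; split=> // Bl; apply: nQB.
    suff <- : B `|` [set l] = B by rewrite gl.
    by apply/setUidPl => _ ->.
apply: (clopen_seq_countably_approachable _ _ (fun n => (BC n).2)) => //.
- by move=> n; have [_ [_ _ _ _ []]] := SBC n.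
- by move=> n; have [_ [_ _ _ _ []]] := SBC n.
- by move=> n; have [_ [_ _ _ _ []]] := SBC n.
have mono m n : (m <= n)%N -> S m `<=` S n.
  move=> mn; rewrite -(subnK mn); elim: (n - m)%N => // k IH; rewrite addSn.
  by have [_ [_ _ sub _ _]] := SBC (k + m)%N; exact: subset_trans sub.
move=> O; rewrite -gT -[in g _](closureT X).
apply: (sel_seq_cvg _ _ setT (fun n => (BC n).1) (fun n => (BC n).2)) => //.
- by exists p.
- move=> x _; have [[m Smx]|nS] := pselect (exists m, S m x).
    exists m => // n /= mn; have [_ [_ + _ _ _]] := SBC n; apply.
    exact: mono mn _ Smx.
  apply: nearW => n; have [_ [_ _ _ + _]] := SBC n; apply => Sx.
  by apply: nS; exists n.+1.
- by move=> n; have [_ []] := SBC n.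
- move=> n y Cy; have [_ [_ _ _ _ [_ _ _ gE]]] := SBC n.
  by rewrite closureT; split=> //; exact: gE.
Qed.

(** Finitely many points force g (T) out of S0, because g X = p is not in S0.
Away from p these points are covered by a clopen set missing p, so
g (B u {p}) is outside S0 for B large; being confined, it is p. *)
Lemma fixing_of_confined (X : topologicalType) (g : set X -> X) (p : X)
    (S0 : set X) :
  hausdorff_space X -> set_selection X g -> totally_disconnected_at p ->
  g [set: X] = p -> clopen S0 -> ~ S0 p ->
  (forall T, closed T -> S0 `<=` T -> T p -> ~ S0 (g T) -> g T = p) ->
  forall S, clopen S -> ~ S p -> exists B,
    [/\ clopen B, S `<=` B, ~ B p & g (B `|` [set p]) = p].
Proof.
move=> hX hg tdp gT clS0 nS0p confined S clS nSp.
have [||K [_ KS]] := sel_approx _ _ hg setT (~` S0); first by exists p.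
  rewrite closureT gT; apply: open_nbhs_nbhs; split=> //.
  by apply: closed_openC; case: clS0.
have [A [clA nAp KA]] := clopen_cover_seq _ p K tdp.
have clB : clopen (S `|` S0 `|` A) by do 2 ?apply: clopenU.
have cBp : closed (S `|` S0 `|` A `|` [set p]).
  by apply: closedU; [case: clB|exact: hausdorff_closed1].
exists (S `|` S0 `|` A); split=> //.
- by move=> x Sx; left; left.
- by case=> [[]|].
- apply: confined => //; [by move=> x Sx; left; left; right|by right|].
  apply: KS => //; last by rewrite closureT.
  by move=> x /KA[Ax|->]; [left; right|right].
Qed.

Theorem corollary1p3 (X : topologicalType) (hX : hausdorff_space X)
  (iX : infinite_set [set: X]) (p : X) (hp : X_Theta X p)
  (bp : butterfly_point p) (tdp : totally_disconnected_at p) :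
  X_Omega X p.
Proof.
have [f [fS fC [S SE fSp]]] := hp.
pose g := extend_selection X f p.
have hg : set_selection X g by exact: extend_set_selection.
have gT : g [set: X] = p by rewrite -SE /g extend_selectionE.
have [[S0 [clS0 nS0p confined]]|nconf] := pselect (exists S0 : set X,
    [/\ clopen S0, ~ S0 p &
     forall T, closed T -> S0 `<=` T -> T p -> ~ S0 (g T) -> g T = p]).
  apply: (approachable_of_fixing _ g) => //.
  exact: (fixing_of_confined _ g p S0).
apply: (approachable_of_escaping _ g) => // S' clS' nS'p.
apply: contrapT => nT; apply: nconf; exists S'; split=> // T cT ST Tp nSg.
by apply: contrapT => gTp; apply: nT; exists T.
Qed.
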